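(* Let $n\ge 2$, let $G=(V,E)$ be a connected non-oriented finite graph with $V=\{1,\ldots,n\}$, and let $\zeta_t$, $t=0,1,2,\ldots$, be a (discrete-time, time-homogeneous) Markov chain with state space $Y=\mathbb{Z}^{n-1}$ and transition probability matrix $Q$. Let $\delta, M\in(0,1)$ be constants. Suppose that the following conditions hold: (i) $Q(x,y)=0$ unless $y=x$ or $y=x+e_i$ for some $1\le i\le n$. (ii) $\inf_{y\in Y}Q(y,y+e_i)\ge\delta$ for all $1\le i\le n$. (iii) Whenever $y\in Y$, $\{i,j\}\in E$ and $f_{ij}(y)>0$, one has $Q(y,y+e_i)\le Q(y,y+e_j)$. (iv) Whenever $y\in Y$ and $i\in V$ are such that $f_{i\ell}(y)>0$ for all $\ell$ with $\{i,\ell\}\in E$, one has $Q(y,y+e_i)\le Q(y,y+e_\ell)-M$ for every $\ell$ with $\{i,\ell\}\in E$. Then the Markov chain $\zeta_t$ is positive recurrent.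
   Context: Edges are unordered pairs $\{i,j\}$ of distinct vertices. The vectors $e_1,\ldots,e_n\in Y=\mathbb{Z}^{n-1}$ are: $e_1,\ldots,e_{n-1}$ the standard basis vectors of $\mathbb{Z}^{n-1}$, and $e_n=(-1,-1,\ldots,-1)$. For $y=(y(1),\ldots,y(n-1))\in Y$ and $1\le i,j\le n$ with $i\ne j$, $$f_{ij}(y)=\begin{cases}y(i)-y(j),&\text{if } i<n,\ j<n,\\ y(i),&\text{if } i<n,\ j=n,\\ -y(j),&\text{if } i=n,\ j<n.\end{cases}$$ *)

(* Defs.v *)
From HB Require Import structures.
From mathcomp Require Import all_boot all_order all_algebra.
From mathcomp Require Import all_classical all_reals all_analysis.

Set Implicit Arguments.
Unset Strict Implicit.
Unset Printing Implicit Defensive.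

Import Order.TTheory GRing.Theory Num.Theory.

Local Open Scope classical_set_scope.
Local Open Scope ring_scope.

Definition simple_graph (V : finType) (edge : rel V) : Prop :=
  symmetric edge /\ irreflexive edge.

Definition connected_graph (V : finType) (edge : rel V) : Prop :=
  forall i j : V, connect edge i j.

Section MarkovChains.
Variables (R : realType) (S : countType).

Definition transition_matrix (Q : S -> S -> R) : Prop :=
  (forall x y, 0 <= Q x y) /\
  (forall x, (\esum_(y in [set: S]) (Q x y)%:E = 1)%E).

Section Process.
Variables (d : measure_display) (T : measurableType d).

Definition path_event (zeta : nat -> T -> S) (p : nat -> S) (t : nat) : set T :=
  [set w | forall s, (s <= t)%N -> zeta s w = p s].

(* [P x] is the law of the process started at [x].  The last clause is the
   time-homogeneous Markov property
   P_x(zeta_{t+1} = p_{t+1} | zeta_0 = p_0, ..., zeta_t = p_t)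
     = Q(p_t, p_{t+1}),
   multiplied out so that conditioning events of probability 0 are harmless. *)
Definition markov_chain (Q : S -> S -> R) (P : S -> probability T R)
    (zeta : nat -> T -> S) : Prop :=
  [/\ forall t y, measurable [set w | zeta t w = y],
      forall x, P x [set w | zeta 0%N w = x] = 1%E &
      forall x t (p : nat -> S),
        P x (path_event zeta p t.+1) =
          (P x (path_event zeta p t) * (Q (p t) (p t.+1))%:E)%E].

(* The first time t >= 1 at which the chain is at [y]; +oo if there is none. *)
Definition return_time (zeta : nat -> T -> S) (y : S) (w : T) : \bar R :=
  ereal_inf [set (t%:R)%:E | t in [set t : nat | (0 < t)%N /\ zeta t w = y]].

Definition positive_recurrent (P : S -> probability T R)
    (zeta : nat -> T -> S) : Prop :=
  forall y,
    P y [set w | (return_time zeta y w < +oo)%E] = 1%E /\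
    (\int[P y]_w return_time zeta y w < +oo)%E.

End Process.
End MarkovChains.

(* The vertices 1, ..., n are the ordinals 0, ..., n - 1 of 'I_n.  For
   [i : 'I_n], [coord_of i] is [Some i'] with [i' = i] as a natural number when
   [i] is not the last vertex, and [None] when it is. *)
Definition coord_of (n : nat) (i : 'I_n) : option 'I_n.-1 := insub (val i).

Definition evec (n : nat) (i : 'I_n) : 'rV[int]_n.-1 :=
  if coord_of i is Some i' then delta_mx 0 i' else const_mx (-1).

(* The value in the last case, i = j = n, is irrelevant. *)
Definition fdiff (n : nat) (i j : 'I_n) (y : 'rV[int]_n.-1) : int :=
  match coord_of i, coord_of j with
  | Some i', Some j' => y 0 i' - y 0 j'
  | Some i', None => y 0 i'
  | None, Some j' => - y 0 j'
  | None, None => 0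
  end.

(* Main.v *)
(* The state is a height profile on the vertices modulo constants, with height
   differences f_ij, and each step raises one vertex by 1 or does nothing.  Let
   V be the sum of f_ij^2 over the edges.  Its drift is at most C - g, where
   g = 2 sum f_ij (q_j - q_i) >= 0 by (iii), so the mean of g along the
   trajectory is at most C + o(1).  By (iv), g is large at a state where some vertex is a
   strict local maximum with a large drop to a neighbour.
   Unless all height differences are below some N, following a path from a
   highest vertex through fast-growing height scales finds one that becomes such
   a maximum after m <= N raises, with a drop exceeding const * (2 / delta)^m; as
   these raises have probability at least delta^m, this forces the expectation
   of g after m steps to be at least const * 2^m.  Summing over m, the chain
   spends half of its time in states with differences at most N.  From those any
   given y is reached in a bounded number of steps with probability bounded
   below, so the expected number of visits to y before time t grows linearly.
   The last-visit decomposition turns this into a bound on the sum over k of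
   P_y(tau_y > k), that is on the mean return time. *)
Require Import Defs.
From HB Require Import structures.
From mathcomp Require Import all_boot all_order all_algebra.
From mathcomp Require Import all_classical all_reals all_analysis.
From mathcomp Require Import measurable_realfun ring lra zify.
Import Order.TTheory GRing.Theory Num.Theory.
Local Open Scope classical_set_scope.
Local Open Scope ring_scope.

Set Implicit Arguments.
Unset Strict Implicit.
Unset Printing Implicit Defensive.

(** * Expectations, occupation times and last visits of a finitely branching chain *)

Section TransitionOperator.
Variables (R : realType) (S : eqType) (I : finType).
Variables (q : S -> I -> R) (step : S -> I -> S).

(** The expectation of [f] after one step from [x]; the [k]-th iterate is the expectation after [k]
    steps. *)
Definition trans (f : S -> R) (x : S) : R := \sum_i q x i * f (step x i).

Hypothesis q_ge0 : forall x i, 0 <= q x i.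
Hypothesis q_sum1 : forall x, \sum_i q x i = 1.

Let T := trans.

Lemma iter_trans_le k f g :
  (forall x, f x <= g x) -> forall x, iter k T f x <= iter k T g x.
Proof.
move=> fg; elim: k => [|k IH] x //=.
by apply: ler_sum => i _; apply: ler_wpM2l.
Qed.

Lemma iter_transD k f g :
  iter k T (fun x => f x + g x) = (fun x => iter k T f x + iter k T g x).
Proof.
elim: k => [|k IH] //=; rewrite IH; apply/funext => x.
by rewrite /T /trans -big_split; apply: eq_bigr => i _; rewrite mulrDr.
Qed.

Lemma iter_transZ k a f :
  iter k T (fun x => a * f x) = (fun x => a * iter k T f x).
Proof.
elim: k => [|k IH] //=; rewrite IH; apply/funext => x.
by rewrite /T /trans mulr_sumr; apply: eq_bigr => i _; rewrite mulrCA.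
Qed.

Lemma iter_trans_cst k a : iter k T (fun=> a) = fun=> a.
Proof.
elim: k => [|k IH] //=; rewrite IH; apply/funext => x.
by rewrite /T /trans -mulr_suml q_sum1 mul1r.
Qed.

Lemma iter_trans_sum k (J : Type) (r : seq J) (F : J -> S -> R) :
  iter k T (fun x => \sum_(j <- r) F j x) =
  (fun x => \sum_(j <- r) iter k T (F j) x).
Proof.
elim: r => [|j r IH].
  under eq_fun do rewrite big_nil.
  by rewrite iter_trans_cst; apply/funext => x; rewrite big_nil.
under eq_fun do rewrite big_cons.
by rewrite iter_transD IH; apply/funext => x; rewrite big_cons.
Qed.

Lemma iter_trans_ge0 k f :
  (forall x, 0 <= f x) -> forall x, 0 <= iter k T f x.
Proof.
by move=> f0 x; rewrite -(congr1 (@^~ x) (iter_trans_cst k 0)) iter_trans_le.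
Qed.

(** The expected drift inequality telescopes over time; the final expectation of [V] is nonnegative
    and is dropped. *)
Lemma iter_trans_drift (V g : S -> R) (C : R) :
    (forall x, 0 <= V x) -> (forall x, T V x <= V x - g x + C) ->
  forall t x, \sum_(s < t) iter s T g x <= V x + t%:R * C.
Proof.
move=> V0 TV t x.
suff H : iter t T V x + \sum_(s < t) iter s T g x <= V x + t%:R * C.
  by apply: le_trans H; rewrite lerDr iter_trans_ge0.
elim: t => [|t IH] /=; first by rewrite big_ord0 mul0r !addr0.
rewrite big_ord_recr /=.
have := iter_trans_le t TV x.
rewrite -iterSr iter_transD iter_trans_cst iterS.
have -> : (fun x => V x - g x) = (fun x => V x + (-1) * g x).
  by apply/funext => z; rewrite mulN1r.
rewrite iter_transD iter_transZ -(natr1 t) mulrDl mul1r => H.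
lra.
Qed.

(** All terms in the expansion of the iterate are nonnegative, so the single trajectory following
    [s] bounds it from below. *)
Lemma iter_trans_trajectory (w : R) (f : S -> R) (s : seq I) :
    (forall x, 0 <= f x) -> 0 <= w -> {in s, forall i x, w <= q x i} ->
  forall x, w ^+ size s * f (foldl step x s) <= iter (size s) T f x.
Proof.
move=> f0 w0; elim: s => [|i s IH] hs x /=; first by rewrite mul1r.
have h0 : 0 <= iter (size s) T f (step x i) by apply: iter_trans_ge0.
rewrite /T /trans (bigD1 i) //= -/T.
rewrite -[leLHS]addr0 lerD //; last first.
  by apply: sumr_ge0 => j _; rewrite mulr_ge0 // iter_trans_ge0.
rewrite exprS -mulrA.
apply: (@le_trans _ _ (w * iter (size s) T f (step x i))).
  rewrite ler_wpM2l //; apply: IH => j js z; apply: hs.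
  by rewrite inE js orbT.
by rewrite ler_wpM2r // hs // mem_head.
Qed.

(** The probability of avoiding [y] at times 1, ..., k. The indicator sits inside [T], so the start
    itself may be [y]. *)
Definition avoid_prob (y : S) (k : nat) : S -> R :=
  iter k (fun f => T (fun x => (x != y)%:R * f x)) (fun=> 1).

Lemma avoid_prob_ge0 y k x : 0 <= avoid_prob y k x.
Proof.
elim: k x => [|k IH] x /=; first by rewrite ler01.
by apply: sumr_ge0 => i _; rewrite !mulr_ge0 ?IH.
Qed.

(* Decomposition of the trajectories of length [t] according to the time [s] of
   the last visit to [y]. *)
Lemma last_visit_decomposition y t x :
  \sum_(s < t.+1) iter s T (fun z => (z == y)%:R) x * avoid_prob y (t - s) y
    + (x != y)%:R * avoid_prob y t x = 1.
Proof.
elim: t x => [|t IH] x.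
  by rewrite big_ord1 /= !mulr1; case: (x == y); rewrite ?addr0 ?add0r.
have /(congr1 (fun f => T f x)) := funext IH.
have -> : T (fun=> 1) x = 1 by have := congr1 (@^~ x) (iter_trans_cst 1 1).
move=> H; apply: etrans H.
rewrite big_ord_recl subn0 [iter _ _ _ _]/=.
(* The new term [s = 0] and the no-visit term merge: together they say that [y] is avoided from time
   1 on, whatever the start. *)
have -> : (x == y)%:R * avoid_prob y t.+1 y = (x == y)%:R * avoid_prob y t.+1 x.
  by case: eqP => [->|]; rewrite ?mul0r.
rewrite addrAC -mulrDl.
have -> : (x == y)%:R + (x != y)%:R = 1 :> R.
  by case: (x == y); rewrite ?addr0 ?add0r.
rewrite mul1r addrC.
have := congr1 (@^~ x) (iter_transD 1
  (fun z => \sum_(s < t.+1)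
     iter s T (fun z0 => (z0 == y)%:R) z * avoid_prob y (t - s) y)
  (fun z => (z != y)%:R * avoid_prob y t z)) => /= ->.
congr (_ + _).
have := congr1 (@^~ x) (iter_trans_sum 1 (index_enum 'I_t.+1)
  (fun (s : 'I_t.+1) z =>
     iter s T (fun z0 => (z0 == y)%:R) z * avoid_prob y (t - s) y)).
move=> /= ->; apply: eq_bigr => s _.
have -> :
    (fun z => iter s T (fun z0 => (z0 == y)%:R) z * avoid_prob y (t - s) y)
   = (fun z => avoid_prob y (t - s) y * iter s T (fun z0 => (z0 == y)%:R) z).
  by apply/funext => z; rewrite mulrC.
have := congr1 (@^~ x) (iter_transZ 1 (avoid_prob y (t - s) y)
  (iter s T (fun z0 => (z0 == y)%:R))) => /= ->.
by rewrite mulrC /bump /= add1n subSS.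
Qed.

(** Renewal argument: the last-visit decompositions at all horizons below t + m add up to t + m and
    dominate A times the expected number of visits before t. Hence A (c t - D) <= t + m for every t,
    and large t forces A <= 1 / c. *)
Lemma sum_avoid_prob_le y (c D : R) :
    0 < c -> (forall t, c * t%:R - D <=
                \sum_(s < t) iter s T (fun z => (z == y)%:R) y) ->
  forall m, \sum_(k < m) avoid_prob y k y <= c^-1.
Proof.
move=> c0 hu m; set A := \sum_(k < m) _.
pose u s := iter s T (fun z => (z == y)%:R) y.
pose r k := avoid_prob y k y.
have u0 s : 0 <= u s by apply: iter_trans_ge0 => z; rewrite ler0n.
have r0 k : 0 <= r k by apply: avoid_prob_ge0.
have one t : \sum_(s < t.+1) u s * r (t - s)%N = 1.
  by have := last_visit_decomposition y t y; rewrite eqxx mul0r addr0.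
have A0 : 0 <= A by apply: sumr_ge0 => k _; apply: r0.
have key t : A * (c * t%:R - D) <= (t + m)%:R.
  apply: (@le_trans _ _ (A * \sum_(s < t) u s)); first by rewrite ler_wpM2l.
  have <- : \sum_(s < t + m) u s * \sum_(k < t + m - s) r k = (t + m)%:R.
    elim: (t + m)%N => [|v IH]; first by rewrite big_ord0.
    rewrite -natr1 -IH -(one v) big_ord_recr /= subSnn big_ord1.
    rewrite [X in _ = _ + X]big_ord_recr /= subnn addrA -big_split /=.
    congr (_ + _); apply: eq_bigr => s _.
    by rewrite subSn 1?ltnW // big_ord_recr mulrDr.
  rewrite mulrC mulr_suml big_split_ord /= -[leLHS]addr0 lerD //; last first.
    by apply: sumr_ge0 => s _; rewrite mulr_ge0 // sumr_ge0.
  apply: ler_sum => s _; rewrite ler_wpM2l // addnC -addnBA 1?ltnW //.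
  by rewrite big_split_ord /= lerDl sumr_ge0.
rewrite leNgt; apply/negP => cA.
have Ac : 0 < A * c - 1 by rewrite subr_gt0 -(mulVf (lt0r_neq0 c0)) ltr_pM2r.
have := archi_boundP
  (divr_ge0 (addr_ge0 (ler0n R m) (normr_ge0 (A * D))) (ltW Ac)).
rewrite ltr_pdivrMr //; set t := Num.Def.archi_bound _.
have := key t; have := ler_norm (A * D); rewrite natrD => h1 h2 h3.
have : (A * c - 1) * t%:R <= m%:R + A * D by nra.
lra.
Qed.

Lemma sum_half_pow k : \sum_(m < k) (2 ^+ m)^-1 <= 2 :> R.
Proof.
have -> : \sum_(m < k) (2 ^+ m)^-1 = 2 - 2 * (2 ^+ k)^-1 :> R.
  elim: k => [|k IH]; first by rewrite big_ord0 expr0 invr1 mulr1 subrr.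
  rewrite big_ord_recr /= IH exprS invfM.
  by have : (2 : R) != 0 by []; move=> ?; field.
by rewrite gerBl mulr_ge0 // invr_ge0 exprn_ge0.
Qed.

(* The factor [2 ^+ m] keeps the total loss bounded independently of [N]. *)
Lemma occupation_ge (V g : S -> R) (C : R) (B : pred S) (N : nat) :
    (forall x, 0 <= V x) -> (forall x, 0 <= g x) -> 0 < C ->
    (forall x, T V x <= V x - g x + C) ->
    (forall z, ~~ B z ->
       exists2 m, (m <= N)%N & 4 * C * 2 ^+ m <= iter m T g z) ->
  forall x t, t%:R / 2 - (V x / (2 * C) + N%:R / 2) <=
              \sum_(s < t) iter s T (fun z => (B z)%:R) x.
Proof.
move=> V0 g0 C0 TV hB x t.
pose W m : R := (4 * C * 2 ^+ m)^-1.
have W0 m : 0 <= W m by rewrite invr_ge0 !mulr_ge0 // ?ltW // exprn_ge0.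
have Wlt m : 0 < 4 * C * 2 ^+ m :> R by rewrite !mulr_gt0 // exprn_gt0.
(* The weights are such that every state outside [B] has some m <= N with [W m] times the expected
   [g] after m steps at least 1. *)
have one z : 1 <= (B z)%:R + \sum_(m < N.+1) W m * iter m T g z.
  have [_|/hB[m mN hm]] := boolP (B z).
    by rewrite lerDl sumr_ge0 // => m _; rewrite mulr_ge0 // iter_trans_ge0.
  rewrite add0r (bigD1 (inord m)) //= inordK //.
  apply: ler_wpDr.
    by apply: sumr_ge0 => k _; rewrite mulr_ge0 // iter_trans_ge0.
  by rewrite /W mulrC ler_pdivlMr // mul1r.
have sum_one s : 1 <= iter s T (fun z => (B z)%:R) x +
    \sum_(m < N.+1) W m * iter (s + m) T g x.
  have := iter_trans_le s one x.
  rewrite iter_trans_cst iter_transD iter_trans_sum => /le_trans; apply.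
  rewrite lerD2l; apply: ler_sum => m _.
  by rewrite iter_transZ iterD.
have : t%:R <= \sum_(s < t) iter s T (fun z => (B z)%:R) x +
    \sum_(s < t) \sum_(m < N.+1) W m * iter (s + m) T g x.
  rewrite -big_split /= -[leLHS](_ : \sum_(s < t) 1 = _).
    by apply: ler_sum => s _; apply: sum_one.
  by rewrite sumr_const card_ord.
(* For each m the drift bound limits the total of [g] to V x + (t + N) C, and the weights sum to at
   most 1 / (2 C); so the time outside [B] is at most t / 2 up to a constant. *)
have : \sum_(s < t) \sum_(m < N.+1) W m * iter (s + m) T g x <=
    (V x + (t + N)%:R * C) / (2 * C).
  rewrite exchange_big /=.
  apply: (@le_trans _ _ (\sum_(m < N.+1) W m * (V x + (t + N)%:R * C))).
    apply: ler_sum => m _; rewrite -mulr_sumr ler_wpM2l //.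
    apply: le_trans (iter_trans_drift V0 TV (t + N) x).
    rewrite (_ : t + N = m + t + (N - m))%N; last by have := ltn_ord m; lia.
    rewrite !big_split_ord /= ler_wpDr //.
      by apply: sumr_ge0 => s _; apply: iter_trans_ge0.
    rewrite ler_wpDl //; first by apply: sumr_ge0 => s _; apply: iter_trans_ge0.
    by apply: ler_sum => s _; rewrite addnC.
  rewrite -mulr_suml mulrC ler_wpM2l //.
    by rewrite addr_ge0 // mulr_ge0 // ltW.
  rewrite (eq_bigr (fun m : 'I_N.+1 => (4 * C)^-1 * (2 ^+ m)^-1)) => [|m _].
    rewrite -mulr_sumr (@le_trans _ _ ((4 * C)^-1 * 2)) //.
      by rewrite ler_wpM2l ?sum_half_pow // invr_ge0 mulr_ge0 // ltW.
    by rewrite le_eqVlt; apply/orP; left; apply/eqP; field; rewrite lt0r_neq0.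
  by rewrite /W invfM.
rewrite natrD.
have -> : (V x + (t%:R + N%:R) * C) / (2 * C) =
          V x / (2 * C) + N%:R / 2 + t%:R / 2.
  by field; rewrite lt0r_neq0.
lra.
Qed.

(** From [B], some time within [K] steps has the chain at [y] with probability at least [e].
    Shifting the time window by k <= K adds at most [K] expected visits, so summing over the K + 1
    shifts keeps a linear rate. *)
Lemma visits_ge (B : pred S) (y x : S) (K : nat) (e D : R) :
    0 < e -> (forall z, B z ->
      exists2 k, (k <= K)%N & e <= iter k T (fun z' => (z' == y)%:R) z) ->
    (forall t, t%:R / 2 - D <= \sum_(s < t) iter s T (fun z => (B z)%:R) x) ->
  exists c D', 0 < c /\ forall t, c * t%:R - D' <=
    \sum_(s < t) iter s T (fun z => (z == y)%:R) x.
Proof.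
move=> e0 hB hD; pose f z : R := (z == y)%:R.
have f0 z : 0 <= f z by rewrite ler0n.
pose u s := iter s T f x.
have u0 s : 0 <= u s by apply: iter_trans_ge0.
have u1 s : u s <= 1.
  rewrite -(congr1 (@^~ x) (iter_trans_cst s 1)); apply: iter_trans_le => z.
  by rewrite /f lern1 leq_b1.
have Bf z : e * (B z)%:R <= \sum_(k < K.+1) iter k T f z.
  have sum0 (Pk : pred 'I_K.+1) : 0 <= \sum_(k < K.+1 | Pk k) iter k T f z.
    by apply: sumr_ge0 => k _; apply: iter_trans_ge0.
  have [/hB[k kK hk]|_] := boolP (B z); last by rewrite mulr0.
  rewrite mulr1 (bigD1 (inord k)) //= inordK //.
  by rewrite (le_trans hk) // lerDl sum0.
have step1 t : e * (t%:R / 2 - D) <= \sum_(k < K.+1) \sum_(s < t) u (s + k)%N.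
  apply: le_trans (ler_wpM2l (ltW e0) (hD t)) _.
  rewrite mulr_sumr exchange_big /=; apply: ler_sum => s _.
  have := iter_trans_le s Bf x.
  rewrite iter_transZ iter_trans_sum => /le_trans; apply.
  by apply: ler_sum => k _; rewrite /u iterD.
have step2 t k : (k < K.+1)%N ->
    \sum_(s < t) u (s + k)%N <= \sum_(s < t) u s + K%:R.
  rewrite ltnS => kK.
  apply: (@le_trans _ _ (\sum_(s < k + t) u s)).
    rewrite big_split_ord /= ler_wpDl ?sumr_ge0 //.
    by apply: ler_sum => s _; rewrite addnC.
  rewrite addnC big_split_ord /= lerD2l.
  apply: (@le_trans _ _ (\sum_(s < k) 1)); first by apply: ler_sum => s _; apply: u1.
  by rewrite sumr_const card_ord ler_nat.
exists (e / (2 * K.+1%:R)), (e * D / K.+1%:R + K%:R); split.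
  by rewrite divr_gt0 // mulr_gt0.
move=> t; rewrite lerBlDr addrA -(ler_pM2r (ltr0Sn R K)).
have : e * (t%:R / 2 - D) <= (\sum_(s < t) u s + K%:R) * K.+1%:R.
  apply: le_trans (step1 t) _.
  apply: (@le_trans _ _ (\sum_(k < K.+1) (\sum_(s < t) u s + K%:R))).
    by apply: ler_sum => k _; apply: step2.
  by rewrite sumr_const card_ord mulr_natr.
have -> : e / (2 * K.+1%:R) * t%:R * K.+1%:R = e * t%:R / 2 by field.
set U := \sum_(s < t) _; rewrite -/U.
have -> : (U + e * D / K.+1%:R + K%:R) * K.+1%:R = (U + K%:R) * K.+1%:R + e * D.
  by field.
lra.
Qed.
End TransitionOperator.

(** * Flat and steep height profiles on a connected graph *)

Fixpoint height_scale (c b k : nat) : nat :=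
  if k is k'.+1 then
    (height_scale c b k' + c * b ^ (height_scale c b k').+1).+1
  else 0.

(* Let [t] be a vertex of maximal height and [s_k] the [k]-th height scale.
   Along a path from [t], either the [k]-th vertex has depth at most [s_k] for
   every [k], or some edge jumps from depth at most [s_k] to depth more than
   [s_(k+1)]; raising its upper end [s_k + 1] times makes it a strict maximum. *)
Lemma flat_or_steep (V : finType) (edge : rel V) (c b : nat) :
    connected_graph edge ->
  exists N : nat, forall h : V -> int,
    (forall i j, h i - h j <= N%:Z) \/
    exists a l m, [/\ edge a l, (m <= N)%N, forall z, h z < h a + m%:Z &
                      (c * b ^ m)%:Z <= h a - h l].
Proof.
move=> conn; pose s := height_scale c b; exists (s #|V|) => h.
have sS k : s k.+1 = (s k + c * b ^ (s k).+1).+1 by [].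
have s_mono : {homo s : i j / (i <= j)%N}.
  by apply: homo_leq => // [|k]; [exact: leq_trans | rewrite sS; lia].
case: (pickP V) => [v0 _|V0]; last by left=> i; have := V0 i.
pose t := [arg max_(i > v0) h i]%O.
have ht z : h z <= h t.
  by rewrite /t; case: Order.TotalTheory.arg_maxP => // i _; apply.
have [/existsP[k /existsP[a /existsP[l /and3P[al hk hl]]]]|no_jump] :=
  boolP [exists k : 'I_#|V|, exists a, exists l,
    [&& edge a l, h t - h a <= (s k)%:Z & (s k.+1)%:Z < h t - h l]].
  (* The drop exceeds s_(k+1) - s_k, which the recursion makes larger than c * b ^ m for m = s_k +
     1. *)
  right; exists a, l, (s k).+1; split=> // [|z|].
  - by apply: leq_trans (s_mono _ _ (ltn_ord k)); rewrite sS; lia.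
  - by have := ht z; lia.
  - by move: hl; rewrite sS; lia.
left=> i j.
have walk p x k : path edge x p -> h t - h x <= (s k)%:Z ->
    (k + size p <= #|V|)%N -> h t - h (last x p) <= (s (k + size p)%N)%:Z.
  elim: p x k => [|z p IH] x k /=; first by rewrite addn0.
  move=> /andP[xz zp] hx; rewrite addnS -addSn => hs.
  apply: IH => //; rewrite leNgt; apply/negP => hz; case/negP: no_jump.
  have hk : (k < #|V|)%N by apply: leq_trans hs; rewrite addSn ltnS leq_addr.
  apply/existsP; exists (Ordinal hk); apply/existsP; exists x.
  by apply/existsP; exists z; apply/and3P.
have /connectP[p tp ->] := conn t j.
(* A path without repeated vertices has fewer than [#|V|] edges, so the scale index stays in
   range. *)
case: (shortenP tp) => p' tp' up' _.
have sp : (size p' < #|V|)%N.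
  by have /card_uniqP := up'; rewrite /= => <-; apply: max_card.
have := walk p' t 0%N tp' _ (ltnW sp); rewrite subrr add0n => /(_ isT) H.
apply: le_trans (le_trans H _); last by rewrite lez_nat s_mono // ltnW.
by rewrite lerD2r.
Qed.

(** * The return time as a sum of tail indicators *)

Section ReturnTime.
Variables (R : realType) (S : countType) (d : measure_display).
Variables (T : measurableType d) (zeta : nat -> T -> S) (y : S).

Definition avoids (t k : nat) : set T :=
  [set w | forall s, (t < s <= t + k)%N -> zeta s w <> y].

(** Tail-sum formula: avoiding [y] at times 1, ..., k means that the return time exceeds k. Without
    a return all terms are 1 and both sides are infinite. *)
Lemma return_time_series w :
  return_time R zeta y w = (\sum_(k <oo) (\1_(avoids 0 k) w)%:E)%E.
Proof.
have ge0 k : (0%N <= k)%N -> true -> (0 <= (\1_(avoids 0 k) w : R)%:E)%E.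
  by rewrite lee_fin.
case: (pselect (exists t, (0 < t)%N && (zeta t w == y))) => [ex|nex]; last first.
  have av k : w \in avoids 0 k.
    rewrite inE => s /andP[s0 _] sy; apply: nex; exists s.
    by rewrite s0 sy eqxx.
  have -> : return_time R zeta y w = +oo%E.
    apply/ereal_inf_pinfty => u [t [t0 ty] _]; exfalso; apply: nex.
    by exists t; rewrite t0 ty eqxx.
  apply/esym/eq_infty => r.
  apply: le_trans (nneseries_lim_ge (Num.Def.archi_bound `|r|) ge0).
  under eq_bigr do rewrite indicE av.
  rewrite sumEFin lee_fin sumr_const_nat subn0.
  by rewrite (le_trans (ler_norm r)) // ltW // archi_boundP.
case: (ex_minnP ex) => t /andP[t0 /eqP ty] tmin.
have av k : (w \in avoids 0 k) = (k < t)%N.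
  apply/idP/idP => [|kt]; rewrite ?inE.
    by move=> h; rewrite ltnNge; apply/negP => tk; apply: (h t) => //; rewrite t0.
  move=> s /andP[s0]; rewrite add0n => sk sy.
  by have := tmin s; rewrite s0 sy eqxx => /(_ isT); lia.
have -> : return_time R zeta y w = (t%:R)%:E.
  apply/eqP; rewrite eq_le; apply/andP; split.
    by apply: ge_ereal_inf; exists (t%:R)%:E => //; exists t.
  apply/ereal_infP => _ [s [s0 sy] <-]; rewrite lee_fin ler_nat.
  by apply: tmin; rewrite s0 sy eqxx.
rewrite (@nneseries_split _ _ 0%N t) => [|k hk]; last exact: ge0.
rewrite add0n eseries0 ?adde0; last first.
  by move=> k tk _; rewrite indicE av ltnNge tk.
rewrite big_nat (eq_bigr (fun=> 1%:E)) => [|k /andP[_ kt]].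
  by rewrite -big_nat sumEFin sumr_const_nat subn0.
by rewrite indicE av kt.
Qed.

Hypothesis zeta_measurable : forall t z, measurable [set w | zeta t w = z].

Lemma measurable_avoids t k : measurable (avoids t k).
Proof.
have -> : avoids t k =
    \bigcap_(s in [set s | (t < s <= t + k)%N]) ~` [set w | zeta s w = y].
  by apply/seteqP; split => w hw s /= hs; apply: hw.
case: (pselect ([set s | (t < s <= t + k)%N] !=set0)) => [h|h].
  by apply: bigcap_measurable => // s _; apply: measurableC.
have -> : [set s | (t < s <= t + k)%N] = set0.
  by apply/seteqP; split => // s hs; case: h; exists s.
by rewrite bigcap_set0.
Qed.

(** Integrating the tail series term by term bounds the mean by [A]; an integrable function is
    finite almost everywhere. *)
Lemma return_time_finite_mean (P : probability T R) (a : nat -> R) (A : R) :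
    (forall k, P (avoids 0 k) <= (a k)%:E)%E ->
    (forall m, \sum_(k < m) a k <= A) ->
  P [set w | (return_time R zeta y w < +oo)%E] = 1%E /\
  (\int[P]_w return_time R zeta y w < +oo)%E.
Proof.
move=> Pa aA.
have mI k : measurable_fun [set: T] (EFin \o (\1_(avoids 0 k) : T -> R)).
  by apply/measurable_EFinP; apply: measurable_indic; apply: measurable_avoids.
have intA : (\int[P]_w return_time R zeta y w <= A%:E)%E.
  under eq_integral do rewrite return_time_series.
  rewrite integral_nneseries //.
  apply: lime_le.
    by apply: is_cvg_nneseries => k _ _; apply: integral_ge0 => w _; rewrite lee_fin.
  apply: nearW => m /=.
  apply: (@le_trans _ _ (\sum_(0 <= k < m) (a k)%:E)%E).
    apply: lee_sum => k _; rewrite integral_indic ?setIT ?Pa //.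
    exact: measurable_avoids.
  by rewrite big_mkord sumEFin lee_fin.
split; last by apply: le_lt_trans intA _; rewrite ltry.
have mrt : measurable_fun setT (return_time R zeta y).
  rewrite (_ : return_time R zeta y = fun w => (\sum_(k <oo) (\1_(avoids 0 k) w)%:E)%E).
    by apply: ge0_emeasurable_sum => // k _; apply: mI.
  by apply/funext => w; rewrite return_time_series.
have rt0 w : (0 <= return_time R zeta y w)%E.
  by rewrite return_time_series nneseries_ge0 // => k _ _; rewrite lee_fin.
have int : P.-integrable setT (return_time R zeta y).
  apply/integrableP; split => //.
  under eq_integral do rewrite gee0_abs //.
  by apply: le_lt_trans intA _; rewrite ltry.
have mfin : measurable [set w | (return_time R zeta y w < +oo)%E].
  by rewrite -[X in measurable X]setTI; apply: emeasurable_fun_infty_o.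
rewrite -[X in P X]setCK probability_setC; last exact: measurableC.
suff -> : P (~` [set w | (return_time R zeta y w < +oo)%E]) = 0%E by rewrite sube0.
apply: measure_negligible; first exact: measurableC.
have [N [mN N0 sub]] := integrable_ae measurableT int.
exists N; split => //; apply: subset_trans sub => w /= h /(_ I) hf.
by apply: h; rewrite ltey_eq hf.
Qed.
End ReturnTime.

(** * Path probabilities under the Markov property *)

Section PathEvents.
Variables (R : realType) (S : countType) (I : finType).
Variables (Q : S -> S -> R) (step : S -> I -> S).
Variables (d : measure_display) (T : measurableType d).
Variables (P : S -> probability T R) (zeta : nat -> T -> S) (y : S).

Let q x i := Q x (step x i).

Hypothesis zeta_markov : markov_chain Q P zeta.
Hypothesis step_inj : forall x, injective (step x).
Hypothesis q_ge0 : forall x i, 0 <= q x i.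
Hypothesis q_sum1 : forall x, \sum_i q x i = 1.

Lemma markov_measurable t z : measurable [set w | zeta t w = z].
Proof. by have [+ _ _] := zeta_markov; apply. Qed.

Lemma measurable_path_event (p : nat -> S) t : measurable (path_event zeta p t).
Proof.
have -> : path_event zeta p t =
    \bigcap_(s in [set s | (s <= t)%N]) [set w | zeta s w = p s].
  by apply/seteqP; split => w hw s /= hs; apply: hw.
apply: bigcap_measurable => [|s _]; first by exists 0%N.
exact: markov_measurable.
Qed.

Lemma measurable_mem t (r : seq S) : measurable [set w | zeta t w \in r].
Proof.
elim: r => [|z r IH].
  by rewrite (_ : [set _ | _] = set0) //; apply/seteqP; split => w.
rewrite (_ : [set _ | _] = [set w | zeta t w = z] `|` [set w | zeta t w \in r]).
  by apply: measurableU => //; apply: markov_measurable.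
apply/seteqP; split => w /=.
  by rewrite in_cons => /orP[/eqP|]; [left|right].
by rewrite in_cons => -[->|->]; rewrite ?eqxx ?orbT.
Qed.

Lemma measure_split_values x t (X : set T) (r : seq S) :
    measurable X -> uniq r ->
  P x (X `&` [set w | zeta t w \in r]) =
  (\sum_(z <- r) P x (X `&` [set w | zeta t w = z]))%E.
Proof.
move=> mX; elim: r => [_|z r IH /= /andP[zr ur]].
  rewrite big_nil (_ : _ `&` _ = set0) ?measure0 //.
  by apply/seteqP; split => w // -[].
rewrite big_cons -IH // -measureU.
- congr (P x _); rewrite -setIUr; congr (_ `&` _).
  apply/seteqP; split => w /=.
    by rewrite in_cons => /orP[/eqP|]; [left|right].
  by rewrite in_cons => -[->|->]; rewrite ?eqxx ?orbT.
- by apply: measurableI => //; apply: markov_measurable.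
- by apply: measurableI => //; apply: measurable_mem.
- apply/seteqP; split => w // -[[_ /= wz] [_ /=]].
  by rewrite wz (negbTE zr).
Qed.

(** Overwriting the path after time [t] lets the Markov property, stated for a fixed path, speak of
    an arbitrary next state [z]. *)
Let extend (p : nat -> S) t z s := if (s <= t)%N then p s else z.

Let path_event_extend p t z :
  path_event zeta (extend p t z) t.+1 =
  path_event zeta p t `&` [set w | zeta t.+1 w = z].
Proof.
apply/seteqP; split => w /= => [h|[h1 h2] s].
  split => [s st|]; first by rewrite h 1?leqW // /extend st.
  by rewrite h // /extend ltnn.
rewrite leq_eqVlt => /orP[/eqP ->|st]; first by rewrite h2 /extend ltnn.
by rewrite h1 // /extend -ltnS st.
Qed.

Let measure_extend x p t z :
  P x (path_event zeta p t `&` [set w | zeta t.+1 w = z]) =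
  (P x (path_event zeta p t) * (Q (p t) z)%:E)%E.
Proof.
have [_ _ h] := zeta_markov; rewrite -path_event_extend h.
have -> : path_event zeta (extend p t z) t = path_event zeta p t.
  by apply/seteqP; split => w hw s st; rewrite hw // /extend st.
by rewrite /extend leqnn ltnn.
Qed.

(** The step probabilities sum to 1, so the successors of [p t] carry the whole mass of the path
    event and the rest of [X] is null. *)
Lemma path_event_supported x p t (X : set T) :
    measurable X -> X `<=` path_event zeta p t ->
  P x X = (\sum_i P x (X `&` [set w | zeta t.+1 w = step (p t) i]))%E.
Proof.
move=> mX Xp; pose r := codom (step (p t)).
have ur : uniq r by apply/injectiveP/step_inj.
have sum_r (X' : set T) : measurable X' ->
    P x (X' `&` [set w | zeta t.+1 w \in r]) =
    (\sum_i P x (X' `&` [set w | zeta t.+1 w = step (p t) i]))%E.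
  by move=> mX'; rewrite measure_split_values // /r codomE big_map big_enum.
rewrite -sum_r //.
have mr := measurable_mem t.+1 r; have mp := measurable_path_event p t.
have split_r (X' : set T) : measurable X' -> P x X' =
    (P x (X' `&` [set w | zeta t.+1 w \in r]) +
     P x (X' `\` [set w | zeta t.+1 w \in r]))%E.
  by move=> mX'; rewrite [LHS](measureDI _ mX' mr) addeC.
rewrite [LHS]split_r // [X in (_ + X)%E](_ : _ = 0%E) ?adde0 //.
apply: (@subset_measure0 _ _ _ _ _ (path_event zeta p t `\` [set w | zeta t.+1 w \in r])).
- exact: measurableD.
- exact: measurableD.
- exact: setSD.
have := split_r _ mp; rewrite sum_r //.
under eq_bigr do rewrite measure_extend.
rewrite -ge0_sume_distrr; last first.
  by move=> i _; rewrite lee_fin q_ge0.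
rewrite sumEFin q_sum1 mule1.
have fp : P x (path_event zeta p t) \is a fin_num by rewrite fin_num_measure.
set Z := (X in (_ + X)%E) => pZ.
have Z0 : Z = 0%E by rewrite -(addeK Z fp) [(Z + _)%E]addeC -pZ subee.
exact: Z0.
Qed.

(** Induction on [k], splitting by the state at time t + 1: a successor other than [y] extends the
    path, and [y] contributes 0 on both sides. *)
Lemma avoids_path_event x p t k :
  P x (path_event zeta p t `&` avoids zeta y t k) =
  (P x (path_event zeta p t) * (avoid_prob q step y k (p t))%:E)%E.
Proof.
have mav t' k' : measurable (avoids zeta y t' k').
  exact/measurable_avoids/markov_measurable.
elim: k t p => [|k IH] t p.
  rewrite mule1; congr (P x _); apply/seteqP; split => w; [by case | move=> h; split => // s].
  by rewrite addn0 => /andP[/leq_trans/[apply]]; rewrite ltnn.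
rewrite (@path_event_supported x p t) //=; last first.
  by apply: measurableI => //; apply: measurable_path_event.
rewrite /trans -sumEFin ge0_sume_distrr; last first.
  by move=> i _; rewrite lee_fin !mulr_ge0 ?q_ge0 ?avoid_prob_ge0.
apply: eq_bigr => i _; set z := step _ i.
have [zy|zy] := eqVneq z y; last first.
  rewrite mul1r EFinM muleA -measure_extend -path_event_extend.
  have := IH t.+1 (extend p t z).
  rewrite {3}/extend ltnn => <-; congr (P x _).
  rewrite path_event_extend setIAC -!setIA; congr (_ `&` _).
  apply/seteqP; split => w /= [h1 h2]; split => // s /andP[st sk].
    by apply: h2; rewrite (ltnW st) addnS -addSn.
  have [->|nst] := eqVneq s t.+1; first by rewrite h1; apply/eqP.
  by apply: h2; rewrite addSnnS sk andbT ltn_neqAle eq_sym nst.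
rewrite !mul0r mulr0 mule0 (_ : _ `&` _ = set0) ?measure0 //.
apply/seteqP; split => w // -[[_ /(_ t.+1)]].
by rewrite ltnSn addnS ltnS leq_addr /= => /(_ isT) h /= wz; case: h; rewrite wz.
Qed.

Lemma avoids_start x k :
  (P x (avoids zeta y 0 k) <= (avoid_prob q step y k x)%:E)%E.
Proof.
have [_ h0 _] := zeta_markov.
have mx := markov_measurable 0 x.
have hp : path_event zeta (fun=> x) 0 = [set w | zeta 0%N w = x].
  apply/seteqP; split => w /= h; first exact: h.
  by move=> s; rewrite leqn0 => /eqP ->.
have ma : measurable (avoids zeta y 0 k) by exact/measurable_avoids/markov_measurable.
have := avoids_path_event x (fun=> x) 0 k; rewrite hp h0 mul1e => <-.
rewrite [leLHS](measureDI _ ma mx) [X in (X + _)%E](_ : _ = 0%E).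
  by rewrite add0e setIC.
apply: (@subset_measure0 _ _ _ _ _ (~` [set w | zeta 0%N w = x])).
- exact: measurableD.
- exact: measurableC.
- by move=> w [].
have z0 : P x (~` [set w | zeta 0%N w = x]) = 0%E.
  by rewrite probability_setC // h0 subee.
exact: z0.
Qed.
End PathEvents.

(** * Heights and the effect of moves on their differences *)

Section Heights.
Variable n : nat.
Implicit Types (y z : 'rV[int]_n.-1) (i j k : 'I_n) (s : seq (option 'I_n)).

(* [Z^(n-1)] is [Z^n] modulo the diagonal: [height y] is the representative of
   [y] which vanishes at the last vertex. *)
Definition height y i : int := if coord_of i is Some i' then y 0 i' else 0.

Lemma fdiffE i j y : fdiff i j y = height y i - height y j.
Proof.
rewrite /fdiff /height; case: (coord_of i) => [i'|]; case: (coord_of j) => [j'|] //.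
- by rewrite subr0.
- by rewrite sub0r.
Qed.

Lemma height_last y i : val i = n.-1 -> height y i = 0.
Proof. by move=> hi; rewrite /height /coord_of insubN // hi ltnn. Qed.

Lemma height_inj y z : (forall i, height y i = height z i) -> y = z.
Proof.
move=> h; apply/matrixP => o i'; rewrite !ord1.
have hi : (i' < n)%N by apply: leq_trans (ltn_ord i') (leq_pred n).
have := h (Ordinal hi); rewrite /height /coord_of.
by rewrite (_ : insub _ = Some i') //; apply: valK.
Qed.

(** Raising the last vertex must be followed by subtracting 1 everywhere, to keep its height at
    0. *)
Lemma height_evec y i k :
  height (y + evec k) i =
  height y i + (i == k)%:R - (coord_of k == None)%:R.
Proof.
rewrite /height /evec /coord_of.
case: (insubP _ (val k)) => [k' kn ek|nk]; case: (insubP _ (val i)) => [i' ei_n ei|ni].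
- rewrite !mxE eqxx /= mulr0n subr0.
  by rewrite -(inj_eq val_inj) ei ek (inj_eq val_inj).
- rewrite (_ : i == k = false) /= ?mulr0n ?subr0 ?addr0 //.
  by apply/eqP => ik; move: ni; rewrite ik kn.
- rewrite !mxE (_ : i == k = false) /= ?mulr0n ?addr0 //.
  by apply/eqP => ik; move: nk; rewrite -ik ei_n.
- rewrite (_ : i == k) ?add0r ?subrr //.
  rewrite -(inj_eq val_inj) /=; have := ltn_ord i; have := ltn_ord k.
  by move: ni nk; rewrite /=; lia.
Qed.

(** [None] is the step that stays put. *)
Definition move y (o : option 'I_n) := y + oapp (@evec n) 0 o.

Lemma fdiff_move y o i j :
  fdiff i j (move y o) = fdiff i j y + (o == Some i)%:R - (o == Some j)%:R.
Proof.
rewrite !fdiffE; case: o => [k|] /=; last by rewrite /move /= !addr0.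
rewrite /move /= !height_evec.
have E a b : (Some a == Some b :> option 'I_n) = (b == a) by rewrite eq_sym.
by rewrite !E; ring.
Qed.

Lemma fdiff_moves y s i j :
  fdiff i j (foldl move y s) =
  fdiff i j y + (count_mem (Some i) s)%:R - (count_mem (Some j) s)%:R.
Proof.
elim: s y => [|o s IH] y /=; first by rewrite addr0 subr0.
by rewrite IH fdiff_move !natrD; ring.
Qed.

(** The changes of the differences f_ij determine the move once there are two vertices to compare;
    thus no transition probability is counted twice. *)
Lemma move_inj y : (2 <= n)%N -> injective (move y).
Proof.
move=> n2 o o' oo'.
have key i j : (o == Some i)%:R - (o == Some j)%:R =
               (o' == Some i)%:R - (o' == Some j)%:R :> int.
  have := congr1 (fdiff i j) oo'; rewrite !fdiff_move -!addrA.
  by move/addrI.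
have other (a : 'I_n) : exists b, a != b.
  have [->|] := eqVneq a (Ordinal n2); last by exists (Ordinal n2).
  by exists (Ordinal (ltnW n2)).
case: o o' key {oo'} => [a|] [b|] key //.
- have [-> //|ab] := eqVneq a b.
  have := key a b; rewrite !eqxx /= (inj_eq Some_inj) (inj_eq Some_inj) eq_sym.
  by rewrite eq_sym (negbTE ab).
- have [b /negbTE ab] := other a.
  by have := key a b; rewrite eqxx /= (inj_eq Some_inj) ab.
- have [a /negbTE ba] := other b.
  by have := key b a; rewrite eqxx /= (inj_eq Some_inj) ba.
Qed.

End Heights.

Lemma esum_codom (R : realType) (S : choiceType) (I : finType) (f : S -> R)
    (g : I -> S) :
    injective g -> (forall y, 0 <= f y) ->
    (forall y, y \notin codom g -> f y = 0) ->
  (\esum_(y in [set: S]) (f y)%:E = (\sum_i f (g i))%:E)%E.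
Proof.
move=> g_inj f0 f_supp.
have -> : (\esum_(y in [set: S]) (f y)%:E = \esum_(y in [set` codom g]) (f y)%:E)%E.
  rewrite [RHS]esum_mkcond; apply: eq_esum => y _; case: ifPn => //.
  by rewrite notin_setE /= => /negP/f_supp ->.
rewrite esum_fset; [|exact: finite_seq|by move=> y _; rewrite lee_fin].
rewrite -fsbig_seq; last exact/injectiveP.
by rewrite codomE big_map big_enum sumEFin.
Qed.

(** * Energy drift, steep states and flat states *)

Section VertexChain.
Variables (R : realType) (n : nat) (edge : rel 'I_n).
Variables (Q : 'rV[int]_n.-1 -> 'rV[int]_n.-1 -> R) (delta M : R).

Hypothesis n_ge2 : (2 <= n)%N.
Hypothesis edge_sym : symmetric edge.
Hypothesis edge_irr : irreflexive edge.
Hypothesis edge_conn : connected_graph edge.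
Hypothesis Q_matrix : transition_matrix Q.
Hypothesis delta_gt0 : 0 < delta.
Hypothesis M_gt0 : 0 < M.
Hypothesis Q_supp : forall x y : 'rV[int]_n.-1,
  ~ (y = x \/ exists i : 'I_n, y = x + evec i) -> Q x y = 0.
Hypothesis Q_ge : forall (i : 'I_n) y, delta <= Q y (y + evec i).
Hypothesis Q_mono : forall (y : 'rV[int]_n.-1) (i j : 'I_n),
  edge i j -> 0 < fdiff i j y -> Q y (y + evec i) <= Q y (y + evec j).
Hypothesis Q_gap : forall (y : 'rV[int]_n.-1) (i : 'I_n),
  (forall l : 'I_n, edge i l -> 0 < fdiff i l y) ->
  forall l : 'I_n, edge i l -> Q y (y + evec i) <= Q y (y + evec l) - M.

Let q (y : 'rV[int]_n.-1) (o : option 'I_n) := Q y (move y o).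
Let T := trans q (@move n).

Lemma move_prob_ge0 y o : 0 <= q y o.
Proof. by have [+ _] := Q_matrix; apply. Qed.

Lemma move_prob_sum1 y : \sum_o q y o = 1.
Proof.
have [Q0 Q1] := Q_matrix; apply: EFin_inj; rewrite -(Q1 y).
rewrite (esum_codom (@move_inj n y n_ge2) (Q0 y)) // => z /codomP hz.
apply: Q_supp => -[zy|[i zy]]; apply: hz.
  by exists None; rewrite /move addr0.
by exists (Some i).
Qed.

(** The sum runs over ordered pairs, so each edge counts twice. *)
Let energy (y : 'rV[int]_n.-1) : R :=
  \sum_(p : 'I_n * 'I_n) (edge p.1 p.2)%:R * ((fdiff p.1 p.2 y)%:~R) ^+ 2.

Let dissipation (y : 'rV[int]_n.-1) : R :=
  \sum_(p : 'I_n * 'I_n) (edge p.1 p.2)%:R *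
    (2 * (fdiff p.1 p.2 y)%:~R * (q y (Some p.2) - q y (Some p.1))).

Let C : R := #|{: 'I_n * 'I_n}|%:R.

Lemma energy_ge0 y : 0 <= energy y.
Proof. by apply: sumr_ge0 => p _; rewrite mulr_ge0 // sqr_ge0. Qed.

(** By (iii) the two factors have the same sign; a negative difference is treated on the reversed
    edge. *)
Lemma dissipation_term_ge0 y (p : 'I_n * 'I_n) :
  0 <= (edge p.1 p.2)%:R *
    (2 * (fdiff p.1 p.2 y)%:~R * (q y (Some p.2) - q y (Some p.1))).
Proof.
case: p => i j /=; have [e|_] := boolP (edge i j); last by rewrite mul0r.
rewrite mul1r -mulrA mulr_ge0 //.
have [f_lt0|f_gt0|->] := ltgtP (fdiff i j y) 0; last by rewrite mul0r.
  apply: mulr_le0; first by rewrite lerz0 ltW.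
  rewrite subr_le0 Q_mono 1?edge_sym //.
  by move: f_lt0; rewrite !fdiffE; lia.
apply: mulr_ge0; first by rewrite ler0z ltW.
by rewrite subr_ge0 Q_mono.
Qed.

Lemma dissipation_ge0 y : 0 <= dissipation y.
Proof. by apply: sumr_ge0 => p _; apply: dissipation_term_ge0. Qed.

Lemma dissipation_ge y a l :
    edge a l -> (forall z, edge a z -> 0 < fdiff a z y) ->
  2 * M * (fdiff a l y)%:~R <= dissipation y.
Proof.
move=> al amax; rewrite /dissipation (bigD1 (a, l)) //= al mul1r ler_wpDr //.
  by apply: sumr_ge0 => p _; apply: dissipation_term_ge0.
rewrite mulrAC -!mulrA ler_wpM2l // mulrC [leRHS]mulrC ler_wpM2r //.
  by rewrite ler0z ltW // amax.
have := Q_gap amax al; rewrite /q /move /=; lra.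
Qed.

(** A move changes f_ij by at most 1. Expanding the square, the linear part gives the dissipation
    and the quadratic part at most 1 per pair, whence [C]. *)
Lemma energy_drift y : T energy y <= energy y - dissipation y + C.
Proof.
have -> : C = \sum_(p : 'I_n * 'I_n) 1 by rewrite sumr_const.
have -> : T energy y = \sum_(p : 'I_n * 'I_n) \sum_o
    q y o * ((edge p.1 p.2)%:R * (fdiff p.1 p.2 (move y o))%:~R ^+ 2).
  rewrite exchange_big /T /trans; apply: eq_bigr => o _.
  by rewrite /energy mulr_sumr.
rewrite /dissipation -sumrN /energy -!big_split /=; apply: ler_sum => -[i j] _ /=.
have [e|_] := boolP (edge i j); last first.
  rewrite !mul0r subr0 add0r big1 ?ler01 // => o _.
  by rewrite mul0r mulr0.
rewrite !mul1r; set f : R := (fdiff i j y)%:~R.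
have ij : i != j by apply: contraTneq e => ->; rewrite edge_irr.
have pick k : \sum_o q y o * (o == Some k)%:R = q y (Some k).
  rewrite (bigD1 (Some k)) //= eqxx mulr1 big1 ?addr0 // => o /negbTE ->.
  by rewrite mulr0.
apply: (@le_trans _ _ (\sum_o (q y o * (f ^+ 2 + 1) +
    2 * f * (q y o * (o == Some i)%:R) - 2 * f * (q y o * (o == Some j)%:R)))).
  apply: ler_sum => o _; rewrite mul1r fdiff_move !rmorphB rmorphD /= -/f.
  rewrite !rmorph_nat.
  have q0 := move_prob_ge0 y o.
  case: (eqVneq o (Some i)) => [->|_]; last first.
    by case: (o == _); rewrite ?mulr1n ?mulr0n; nra.
  rewrite (inj_eq Some_inj) (negbTE ij) mulr1n mulr0n; nra.
rewrite sumrB big_split /= -mulr_suml move_prob_sum1 -!mulr_sumr !pick.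
lra.
Qed.

Lemma move_trajectory (f : 'rV[int]_n.-1 -> R) (s : seq 'I_n) y :
    (forall z, 0 <= f z) ->
  delta ^+ size s * f (foldl (@move n) y (map Some s)) <= iter (size s) T f y.
Proof.
move=> f0; rewrite -(size_map Some).
apply: (iter_trans_trajectory (@move n) move_prob_ge0 move_prob_sum1) => //.
  exact: ltW.
by move=> o /mapP[i _ ->] x; apply: Q_ge.
Qed.

Let flat (N : nat) y := [forall i : 'I_n, forall j : 'I_n, fdiff i j y <= N%:Z].

(** In a steep state, m raises of [a], of probability at least delta^m, create a strict local
    maximum with drop at least c b^m; by (iv) the expected dissipation is then at least 2 M c (delta
    b)^m. *)
Lemma not_flat_drift (L : R) : 0 < L ->
  exists N : nat, forall y, ~~ flat N y ->
    exists2 m, (m <= N)%N & L * 2 ^+ m <= iter m T dissipation y.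
Proof.
move=> L0.
(* Chosen so that delta b >= 2 and 2 M c >= L. *)
pose b := Num.Def.archi_bound (2 / delta).
pose c := Num.Def.archi_bound (L / (2 * M)).
have hb : 2 <= delta * b%:R.
  rewrite mulrC -ler_pdivrMr // ltW // archi_boundP //.
  by rewrite divr_ge0 // ltW.
have hc : L <= 2 * M * c%:R.
  rewrite mulrC -ler_pdivrMr ?mulr_gt0 // ltW // archi_boundP //.
  by rewrite divr_ge0 ?mulr_ge0 // ltW.
have [N hN] := flat_or_steep c b edge_conn; exists N => y.
have [hf|[a [l [m [al mN amax gap]]]] nf] := hN (height y).
  case/negP; apply/forallP => i; apply/forallP => j.
  by rewrite fdiffE.
exists m => //.
have := move_trajectory (nseq m a) y dissipation_ge0; rewrite size_nseq.
set z := foldl _ _ _; apply: le_trans.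
have fz k : k != a -> fdiff a k z = fdiff a k y + m%:R.
  move=> ka; rewrite fdiff_moves map_nseq !count_nseq /= eqxx mul1n.
  by rewrite (inj_eq Some_inj) eq_sym (negbTE ka) subr0.
have ne k : edge a k -> k != a by apply: contraTneq => ->; rewrite edge_irr.
have zmax k : edge a k -> 0 < fdiff a k z.
  move=> /ne ka; rewrite fz // fdiffE; have := amax k; lia.
have := dissipation_ge al zmax.
have : (c * b ^ m)%:R <= (fdiff a l z)%:~R :> R.
  rewrite fz ?ne // -[leLHS]/((c * b ^ m)%:Z%:~R) ler_int fdiffE.
  by apply: le_trans gap _; rewrite lerDl.
rewrite natrM natrX => h1 h2.
apply: (@le_trans _ _ (delta ^+ m * (2 * M * (c%:R * b%:R ^+ m)))); last first.
  apply: ler_wpM2l; first by rewrite exprn_ge0 // ltW.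
  apply: le_trans h2.
  by rewrite ler_wpM2l // mulr_ge0 // ltW.
rewrite (_ : delta ^+ m * _ = 2 * M * c%:R * (delta * b%:R) ^+ m); last first.
  by rewrite exprMn; ring.
rewrite ler_pM // ?exprn_ge0 //; first exact: ltW.
by apply: lerXn2r; rewrite ?nnegrE //; apply: le_trans hb.
Qed.

(** Only height differences matter, so raises alone lead to [y]: the target is its profile lifted by
    a constant [H]. *)
Lemma flat_reaches (N : nat) y :
  exists (K : nat) (e : R), 0 < e /\
    forall z, flat N z -> exists2 k, (k <= K)%N &
      e <= iter k T (fun x => (x == y)%:R) z.
Proof.
have hlast : (n.-1 < n)%N by lia.
pose last := Ordinal hlast.
pose H := (N + \sum_i `|height y i|)%N.
pose K := (\sum_(i < n) (H + H))%N.
exists K, (Num.min delta 1 ^+ K); split.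
  by rewrite exprn_gt0 // lt_min delta_gt0 ltr01.
move=> z flz.
(* The number of raises needed at [i]; for flat [z] the choice of [H] makes it nonnegative, so
   [absz] changes nothing. *)
pose c i := absz (H%:Z + height y i - height z i)%R.
have hz i : `|height z i| <= N%:Z.
  have := forallP (forallP flz i) last; have := forallP (forallP flz last) i.
  by rewrite !fdiffE (@height_last _ z last) //; lia.
have hy i : `|height y i| <= (H - N)%N%:Z.
  rewrite /H addKn (bigD1 i) //=; lia.
have cE i : (c i)%:Z = H%:Z + height y i - height z i.
  by have := hz i; have := hy i; rewrite /c /H; lia.
have c_le i : (c i <= H + H)%N.
  by have := hz i; have := hy i; have := cE i; rewrite /H; lia.
pose s : seq 'I_n := \big[cat/[::]]_i nseq (c i) i.
have count_s j : count_mem j s = c j.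
  rewrite /s (big_morph _ (count_cat (pred1 j)) erefl) (bigD1 j) //=.
  rewrite count_nseq /= eqxx mul1n big1 ?addn0 // => i /negbTE ij.
  by rewrite count_nseq /= ij.
have size_s : size s = (\sum_i c i)%N.
  rewrite /s (big_morph _ (@size_cat _) erefl); apply: eq_bigr => i _.
  by rewrite size_nseq.
have sK : (size s <= K)%N by rewrite size_s; apply: leq_sum.
exists (size s) => //.
pose f x : R := (x == y)%:R.
have f0 x : 0 <= f x by rewrite ler0n.
apply: le_trans (move_trajectory s z f0).
have -> : foldl (@move n) z (map Some s) = y.
  apply: height_inj => i.
  have last0 x : height x last = 0 by apply: height_last.
  have := fdiff_moves z (map Some s) i last; rewrite !fdiffE !last0 !subr0.
  rewrite !count_map !(eq_count (a2 := pred1 _) (fun _ => inj_eq Some_inj _ _)).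
  rewrite !count_s => ->; rewrite !natz !cE !last0; lia.
rewrite /f eqxx mulr1.
apply: (@le_trans _ _ (Num.min delta 1 ^+ size s)).
  apply: ler_wiXn2l => //; last by rewrite ge_min lexx orbT.
  by rewrite le_min ltW //= ler01.
apply: lerXn2r; last by rewrite ge_min lexx.
  by rewrite nnegrE le_min ler01 ltW.
by rewrite nnegrE ltW.
Qed.

Lemma sum_return_bounded y :
  exists A : R, forall m, \sum_(k < m) avoid_prob q (@move n) y k y <= A.
Proof.
have C0 : 0 < C.
  rewrite ltr0n; apply/card_gt0P.
  by have i : 'I_n := Ordinal n_ge2; exists (i, i).
(* This takes L = 4 C, the threshold in [occupation_ge]. *)
have [N hN] := not_flat_drift (mulr_gt0 (ltr0Sn R 3) C0).
have [K [e [e0 he]]] := flat_reaches N y.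
have occ := occupation_ge move_prob_ge0 move_prob_sum1 energy_ge0
  dissipation_ge0 C0 energy_drift hN y.
have [c [D [c0 hD]]] := visits_ge move_prob_ge0 move_prob_sum1 e0 he occ.
by exists c^-1; apply: (sum_avoid_prob_le move_prob_ge0 move_prob_sum1 c0 hD).
Qed.
End VertexChain.

Theorem theorem1p3 (R : realType) (n : nat) (hn : (2 <= n)%N)
    (edge : rel 'I_n) (hG : simple_graph edge) (hconn : connected_graph edge)
    (Q : 'rV[int]_n.-1 -> 'rV[int]_n.-1 -> R) (hQ : transition_matrix Q)
    (d : measure_display) (T : measurableType d)
    (P : 'rV[int]_n.-1 -> probability T R) (zeta : nat -> T -> 'rV[int]_n.-1)
    (hzeta : markov_chain Q P zeta)
    (delta M : R) (hdelta : 0 < delta < 1) (hM : 0 < M < 1)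
    (hi : forall x y : 'rV[int]_n.-1,
       ~ (y = x \/ exists i : 'I_n, y = x + evec i) -> Q x y = 0)
    (hii : forall i : 'I_n,
       delta <= inf [set Q y (y + evec i) | y in [set: 'rV[int]_n.-1]])
    (hiii : forall (y : 'rV[int]_n.-1) (i j : 'I_n),
       edge i j -> 0 < fdiff i j y -> Q y (y + evec i) <= Q y (y + evec j))
    (hiv : forall (y : 'rV[int]_n.-1) (i : 'I_n),
       (forall l : 'I_n, edge i l -> 0 < fdiff i l y) ->
       forall l : 'I_n, edge i l ->
         Q y (y + evec i) <= Q y (y + evec l) - M) :
  positive_recurrent P zeta.
Proof.
have [edge_sym edge_irr] := hG.
have /andP[delta0 _] := hdelta; have /andP[M0 _] := hM.
(* [inf] has a default value on sets without a lower bound, so the lower bound 0 is supplied. *)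
have Q_ge i y : delta <= Q y (y + evec i).
  apply: le_trans (hii i) _; apply: ge_inf; last by exists y.
  by exists 0 => _ [z _ <-]; have [+ _] := hQ; apply.
have q_ge0 y o : 0 <= Q y (move y o) by have [+ _] := hQ; apply.
have q_sum1 := move_prob_sum1 hn hQ hi.
move=> y.
have [A hA] := sum_return_bounded hn edge_sym edge_irr hconn hQ delta0 M0 hi
  Q_ge hiii hiv y.
have hm : forall t z, measurable [set w | zeta t w = z] by have [] := hzeta.
apply: (return_time_finite_mean hm _ hA) => k.
exact: (avoids_start y hzeta (fun x => @move_inj n x hn) q_ge0 q_sum1).
Qed.
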